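(* Let $\mathcal L$ be an indecomposable noncommutative Lie algebra over a field. Then $\Gamma(\mathcal L)$ is disconnected if and only if there is a nonempty set $\mathcal S\subsetneq V_{\mathcal L}$ such that $\ker(\mathrm{ad}_x)\subseteq\mathcal S\cup Z(\mathcal L)$ for every $x\in\mathcal S$.
   Context: For a noncommutative (i.e. nonabelian) Lie algebra $\mathcal L$ with center $Z(\mathcal L)$, the commuting graph $\Gamma(\mathcal L)$ is the simple undirected graph with vertex set $V_{\mathcal L}=\mathcal L\setminus Z(\mathcal L)$, in which two distinct vertices $x,y$ are adjacent if and only if $[x,y]=0$. A graph is connected if every pair of distinct vertices is joined by a path, and disconnected otherwise. $\mathrm{ad}_x(y)=[x,y]$. A Lie algebra is indecomposable if it is not the direct sum (as Lie algebras) of two non-trivial Lie subalgebras. *)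

(* Defs.v *)
From HB Require Import structures.
From mathcomp Require Import all_boot all_order all_algebra.
From mathcomp Require Import boolp classical_sets.

Set Implicit Arguments.
Unset Strict Implicit.
Unset Printing Implicit Defensive.

Import GRing.Theory.

Local Open Scope classical_set_scope.
Local Open Scope ring_scope.

Record sgraph (T : choiceType) := SGraph {
  vertices : set T;
  adjacent : rel T;
  adjacent_sym : symmetric adjacent;
  adjacent_irrefl : irreflexive adjacent;
  adjacent_vertices : forall x y, adjacent x y -> vertices x /\ vertices y
}.

Definition joined_by_path (T : choiceType) (G : sgraph T) (x y : T) : Prop :=
  exists p : seq T, [/\ path (adjacent G) x p, uniq (x :: p) & last x p = y].

Definition connected_graph (T : choiceType) (G : sgraph T) : Prop :=
  forall x y, vertices G x -> vertices G y -> x <> y -> joined_by_path G x y.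

Definition disconnected_graph (T : choiceType) (G : sgraph T) : Prop :=
  ~ connected_graph G.

HB.mixin Record Lmodule_isLieAlgebra (F : fieldType) L of GRing.Lmodule F L := {
  lie : L -> L -> L;
  lie_linearl : forall y, linear (lie^~ y);
  lie_linearr : forall x, linear (lie x);
  lie_alternating : forall x, lie x x = 0;
  lie_jacobi : forall x y z,
    lie x (lie y z) + lie y (lie z x) + lie z (lie x y) = 0
}.

#[short(type="lieAlgType")]
HB.structure Definition LieAlgebra (F : fieldType) :=
  { L of GRing.Lmodule F L & Lmodule_isLieAlgebra F L }.

Section LieAlgebraTheory.
Variables (F : fieldType) (L : lieAlgType F).
Implicit Types (x y : L) (A B : set L).

Definition ad x : L -> L := fun y => lie x y.

Definition ker_ad x : set L := ad x @^-1` [set 0].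

Definition lie_center : set L := [set z | forall x, lie z x = 0].

Definition noncommutative_lie : Prop := exists x y, lie x y <> 0.

Definition lie_subalgebra A : Prop :=
  submod_closed [in A] /\ {in A &, forall x y, lie x y \in A}.

(* [L] is the internal direct sum of the Lie algebras [A] and [B]: its bracket
   is computed componentwise, so that the cross brackets vanish. *)
Definition lie_direct_sum A B : Prop :=
  [/\ [set a + b | a in A & b in B] = setT,
      A `&` B = [set 0] &
      {in A & B, forall a b, lie a b = 0}].

(* Nontrivial means nonzero: a summand equal to [L] leaves [0] as the other. *)
Definition indecomposable_lie : Prop :=
  ~ exists A B, [/\ lie_subalgebra A, lie_subalgebra B,
                    A <> [set 0], B <> [set 0] & lie_direct_sum A B].

Lemma lieC x y : lie x y = - lie y x.
Proof.
have lieD u v w : lie (u + v) w = lie u w + lie v w.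
  by have := lie_linearl w 1 u v; rewrite !scale1r.
have lieDr u v w : lie w (u + v) = lie w u + lie w v.
  by have := lie_linearr w 1 u v; rewrite !scale1r.
have := lie_alternating (x + y).
rewrite lieD !lieDr !lie_alternating add0r addr0 => /eqP.
by rewrite addr_eq0 => /eqP.
Qed.

Definition noncentral : set L := ~` lie_center.

Definition commuting_adj : rel L := fun x y =>
  [&& x \in noncentral, y \in noncentral, x != y & lie x y == 0].

Lemma commuting_adj_sym : symmetric commuting_adj.
Proof.
move=> x y; rewrite /commuting_adj andbCA eq_sym.
by rewrite [lie x y]lieC oppr_eq0.
Qed.

Lemma commuting_adj_irrefl : irreflexive commuting_adj.
Proof. by move=> x; rewrite /commuting_adj eqxx !andbF. Qed.

Lemma commuting_adj_noncentral x y :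
  commuting_adj x y -> noncentral x /\ noncentral y.
Proof. by case/and4P => /set_mem ? /set_mem ? _ _. Qed.

Definition commuting_graph : sgraph L :=
  SGraph commuting_adj_sym commuting_adj_irrefl commuting_adj_noncentral.

End LieAlgebraTheory.

Arguments noncommutative_lie {F} L.
Arguments indecomposable_lie {F} L.
Arguments lie_center {F} L.
Arguments commuting_graph {F} L.

(* Main.v *)
Require Import Defs.
From mathcomp Require Import all_boot all_order all_algebra.
From mathcomp Require Import boolp classical_sets.

(** The proposition combines a fact about arbitrary graphs with a reading of
    the commuting graph.

    A graph is disconnected exactly when some nonempty proper set of vertices
    is closed under adjacency ([disconnected_graphP]): the component of one of
    two unjoined vertices is such a set, and conversely a path that starts in
    a closed set cannot leave it.

    In the commuting graph, the kernel of [ad x] for a noncentral [x] consists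
    of [x], its neighbours and the center.  Hence a set of noncentral elements
    is closed under adjacency exactly when it contains, up to the center, the
    kernel of [ad x] for each of its elements ([commuting_closedP]). *)

Local Open Scope classical_set_scope.

Section Graphs.
Variables (T : choiceType) (G : sgraph T).
Implicit Types (x y : T) (S : set T).

Definition adjacency_closed S : Prop :=
  forall x y, S x -> adjacent G x y -> S y.

(** Loops can be cut out of a walk, so the requirement that a path be simple
    does not change which vertices it joins. *)
Lemma walk_joined x p : path (adjacent G) x p -> joined_by_path G x (last x p).
Proof. by case/shortenP=> q px uq _; exists q. Qed.

Lemma joined_by_path_refl x : joined_by_path G x x.
Proof. exact: (@walk_joined x [::]). Qed.

Lemma joined_by_path_step x y z :
  joined_by_path G x y -> adjacent G y z -> joined_by_path G x z.
Proof.
move=> [p [xp _ yE]] yz; rewrite -(last_rcons x p z).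
by apply: walk_joined; rewrite rcons_path xp yE.
Qed.

Lemma adjacency_closed_joined S x y :
  adjacency_closed S -> S x -> joined_by_path G x y -> S y.
Proof.
move=> clS Sx [p [xp _ <-]].
elim: p x Sx xp => //= z p IHp x Sx /andP[xz zp].
by apply: IHp zp; apply: clS xz.
Qed.

Lemma disconnected_graphP :
  disconnected_graph G <->
  exists S, [/\ S !=set0, S `<` vertices G & adjacency_closed S].
Proof.
split=> [disG|[S [[x Sx] [SV VS] clS]] conG]; last first.
  apply: VS => y Vy; have [<-//|xy] := pselect (x = y).
  by apply: (adjacency_closed_joined S x y clS Sx); apply: conG => //; apply: SV.
apply: contrapT => noS; apply: disG => x y Vx Vy _.
apply: contrapT => nxy; apply: noS.
exists [set z | vertices G z /\ joined_by_path G x z]; split.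
- by exists x; split=> //; apply: joined_by_path_refl.
- by split=> [z []//|/(_ y Vy)[_]].
- move=> z w [_ xz] zw; split; last exact: joined_by_path_step zw.
  by have [] := adjacent_vertices zw.
Qed.

End Graphs.

(** An element of [ker_ad x] is central, or equal to [x], or a neighbour of
    [x]; this trichotomy turns closure under adjacency into the condition on
    kernels. *)
Lemma commuting_closedP (F : fieldType) (L : lieAlgType F) (S : set L) :
  S `<=` vertices (commuting_graph L) ->
  adjacency_closed L (commuting_graph L) S <->
  (forall x, S x -> ker_ad x `<=` S `|` lie_center L).
Proof.
move=> SV; split=> [clS x Sx y xy|kerS x y Sx].
  have [?|Vy] := pselect (lie_center L y); first by right.
  left; have [<-//|/eqP neq_xy] := pselect (x = y).
  apply: (clS x y Sx); apply/and4P; split=> //.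
  - exact: mem_set (SV x Sx).
  - exact: mem_set Vy.
  - exact/eqP.
by case/and4P=> _ /set_mem Vy _ /eqP /(kerS x Sx)[|/Vy].
Qed.

Theorem proposition9 (F : fieldType) (L : lieAlgType F)
  (indecL : indecomposable_lie L) (ncL : noncommutative_lie L) :
  disconnected_graph (commuting_graph L) <->
  exists S : set L,
    [/\ S !=set0,
        S `<` vertices (commuting_graph L) &
        forall x : L, S x -> ker_ad x `<=` S `|` lie_center L].
Proof.
rewrite disconnected_graphP.
by split=> -[S [S0 SV clS]]; exists S; split=> //;
  apply/(commuting_closedP F L S (properW SV)).
Qed.
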